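(* Let $m$ be a nonnegative integer and let $a$ be an indeterminate. Then the sum of the weights of all Meixner bi-endofunctions on $[m]=\{1,2,\ldots,m\}$ equals the sum of the weights of all Meixner endofunctions on $[m]$, where the weights are the ones defined in the context (they depend on $m$ and $a$): $$\sum_{(A,B,C;\pi_A;\pi_B,\pi_C)} w(A,B,C;\pi_A;\pi_B,\pi_C)=\sum_{(A,B;\pi_A;\pi_B)} w'(A,B;\pi_A;\pi_B),$$ the left sum ranging over all Meixner bi-endofunctions on $[m]$ and the right sum over all Meixner endofunctions on $[m]$.
   Context: A composition $(A,B)$ (respectively $(A,B,C)$) of a finite set $S$ is an ordered pair (respectively triple) of pairwise disjoint, possibly empty, subsets of $S$ whose union is $S$; equivalently, a coloring of $S$ by 2 (respectively 3) colors. A Meixner endofunction on a finite set $S$ is a tuple $(A,B;\pi_A;\pi_B)$, where $(A,B)$ is a composition of $S$, $\pi_A$ is an injective map from $A$ to $S=A\cup B$, and $\pi_B$ is a permutation of $B$. A Meixner bi-endofunction on a finite set $S$ is a tuple $(A,B,C;\pi_A;\pi_B,\pi_C)$, where $(A,B,C)$ is a composition of $S$, $\pi_A$ is an injective map from $A$ to $A\cup B$, $\pi_B$ is a permutation of $B$, and $\pi_C$ is a permutation of $C$. The functional digraph of an injective map $\pi_A:A\to A\cup B$ (with $A,B$ disjoint) is the digraph on $A\cup B$ with arcs $(k,\pi_A(k))$ for $k\in A$. It decomposes uniquely into disjoint cycles on elements of $A$ and directed paths ending at an element of $B$. The cycles of $\pi_A$ are the cycles of this digraph (fixed points count as cycles).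 The cycles of the permutations $\pi_B,\pi_C$ are their usual cycles, including fixed points. Weight $w$ of a Meixner bi-endofunction $(A,B,C;\pi_A;\pi_B,\pi_C)$ on $[m]$: each element of $A$, $B$, $C$ has weight $\frac{-a+1}{2}$, $\frac{a+1}{2}$, $1$, respectively; each cycle of $\pi_A$, $\pi_B$, $\pi_C$ has weight $\frac12$, $-m-\frac12$, $-m$, respectively. The weight $w$ is the product of the weights of all elements and the weights of all cycles. Weight $w'$ of a Meixner endofunction $(A,B;\pi_A;\pi_B)$ on $[m]$: each element of $A$ has weight $1$ and each element of $B$ has weight $\frac{-a-1}{2}$; each cycle of $\pi_A$ has weight $\frac12-m$ and each cycle of $\pi_B$ has weight $1+m$. The weight $w'$ is the product of the weights of all elements and the weights of all cycles. *)

(* Defs.v *)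
From HB Require Import structures.
From mathcomp Require Import all_boot all_order all_algebra all_fingroup.

Set Implicit Arguments.
Unset Strict Implicit.
Unset Printing Implicit Defensive.

Import GRing.Theory.
Local Open Scope ring_scope.

(* Compositions are ordered tuples of possibly empty blocks, hence sets
   that are not required to form a [partition] in the sense of finset. *)
Definition is_composition2 (T : finType) (c : {set T} * {set T}) : bool :=
  let: (A, B) := c in [disjoint A & B] && (A :|: B == [set: T]).

Definition is_composition3 (T : finType)
    (c : {set T} * {set T} * {set T}) : bool :=
  let: (A, B, C) := c in
  [&& [disjoint A & B], [disjoint A & C], [disjoint B & C]
    & A :|: B :|: C == [set: T]].

Definition composition2 (T : finType) : Type :=
  {c : {set T} * {set T} | is_composition2 c}.

Definition composition3 (T : finType) : Type :=
  {c : {set T} * {set T} * {set T} | is_composition3 c}.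

HB.instance Definition _ (T : finType) := Finite.on (composition2 T).
HB.instance Definition _ (T : finType) := Finite.on (composition3 T).

Definition block2A (T : finType) (c : composition2 T) : {set T} := (val c).1.
Definition block2B (T : finType) (c : composition2 T) : {set T} := (val c).2.
Definition block3A (T : finType) (c : composition3 T) : {set T} := (val c).1.1.
Definition block3B (T : finType) (c : composition3 T) : {set T} := (val c).1.2.
Definition block3C (T : finType) (c : composition3 T) : {set T} := (val c).2.

Definition injection (T : finType) (A D : {set T}) : Type :=
  {f : {ffun {x | x \in A} -> {x | x \in D}} | injectiveb f}.

HB.instance Definition _ (T : finType) (A D : {set T}) :=
  Finite.on (injection A D).

Definition perm_of_set (T : finType) (B : {set T}) : Type :=
  {perm {x | x \in B}}.

HB.instance Definition _ (T : finType) (B : {set T}) :=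
  Finite.on (perm_of_set B).

Definition meixner_endo (T : finType) : Type :=
  {c : composition2 T & (injection (block2A c) (block2A c :|: block2B c)
                         * perm_of_set (block2B c))%type}.

Definition meixner_bi_endo (T : finType) : Type :=
  {c : composition3 T & (injection (block3A c) (block3A c :|: block3B c)
                         * perm_of_set (block3B c)
                         * perm_of_set (block3C c))%type}.

HB.instance Definition _ (T : finType) := Finite.on (meixner_endo T).
HB.instance Definition _ (T : finType) := Finite.on (meixner_bi_endo T).

Definition functional_digraph (T : finType) (A D : {set T})
    (f : injection A D) : rel T :=
  fun x y => [exists k : {x | x \in A}, (val k == x) && (val (val f k) == y)].

(* The vertex sets of the directed cycles of [e]. In a functional digraph each
   vertex has at most one out-neighbour, so a cycle is determined by its
   vertex set. *)
Definition digraph_cycles (T : finType) (e : rel T) : {set {set T}} :=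
  [set O : {set T} | (O != set0) &&
     [exists p : #|O|.-tuple T, ucycleb e p && (O == [set x in p])]].

Definition injection_cycles (T : finType) (A D : {set T})
    (f : injection A D) : {set {set T}} :=
  digraph_cycles (functional_digraph f).

Definition perm_cycles (T : finType) (B : {set T}) (s : perm_of_set B) :
    {set {set {x | x \in B}}} :=
  porbits s.

Definition bi_endo_weight (m : nat) (g : meixner_bi_endo 'I_m) : {poly rat} :=
  let: existT c (piA, piB, piC) := g in
    (\prod_(x in block3A c) (2^-1 *: (- 'X + 1)))
  * (\prod_(x in block3B c) (2^-1 *: ('X + 1)))
  * (\prod_(x in block3C c) 1)
  * (\prod_(O in injection_cycles piA) (2^-1)%:P)
  * (\prod_(O in perm_cycles piB) (- m%:R - 2^-1)%:P)
  * (\prod_(O in perm_cycles piC) (- m%:R)%:P).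

Definition endo_weight (m : nat) (g : meixner_endo 'I_m) : {poly rat} :=
  let: existT c (piA, piB) := g in
    (\prod_(x in block2A c) 1)
  * (\prod_(x in block2B c) (2^-1 *: (- 'X - 1)))
  * (\prod_(O in injection_cycles piA) (2^-1 - m%:R)%:P)
  * (\prod_(O in perm_cycles piB) (1 + m%:R)%:P).

(* Main.v *)
Require Import Defs.
From mathcomp Require Import all_boot all_order all_algebra all_fingroup.
From mathcomp Require Import ring.

(** Write [rising u n] for the rising factorial u (u + 1) ... (u + n - 1).
    Counting cycles with weight u, the permutations of an n-set sum to
    [rising u n], and the injections from A to A :|: B, where A and B are
    disjoint, sum to [rising (u + #|B|) #|A|]: an element x of A is inserted
    into such a structure either as a new fixed point, with weight u, or just
    before one of the elements already present, which leaves the number of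
    cycles unchanged.  Injections are reduced to permutations: an injection
    from A to S extends to #|S :\: A|`! permutations of S, and its cycles are
    the cycles contained in A of any of these extensions
    ([sum_injection_cycles]), so that the insertion argument is only needed for
    permutations ([sum_perm_porbits_in]).

    Both sides of the theorem thereby become sums, over the compositions of
    the m-set, of products of powers and rising factorials.  In terms of exponential
    generating functions, where the rising factorials of u have generating
    function (1 - z)^(-u), the left side is, with x = (1 - a)/2, the
    coefficient of z^m / m! in
      (1 - z)^m (1 - x z)^(-1/2) (1 - (1 - x) z / (1 - x z))^(m + 1/2),
    the right side is its coefficient in
      (1 - z)^(m - 1/2) (1 - (x - 1) z / (1 - z))^(-m - 1),
    and both series are equal to (1 - z)^(2 m + 1/2) (1 - x z)^(-m - 1).

    The proof follows this computation on sums over subsets, where a product of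
    generating functions is a sum over the ways to split a set in two.  The
    product of two powers of 1 - z is the Vandermonde identity
    ([rising_Vandermonde]), and the simplification
      (1 - x z)^(-b) (1 - t z / (1 - x z))^(-a)
        = (1 - x z)^(a - b) (1 - (x + t) z)^(-a)
    is [meixner_resum].  Both sides are instances of the latter, with x + t = 1
    on the left and with x = 1 on the right ([meixner_identity]). *)

Set Implicit Arguments.
Unset Strict Implicit.
Unset Printing Implicit Defensive.

Import GRing.Theory.
Local Open Scope ring_scope.

(** * Rising factorials and sums over subsets *)

Definition rising (R : pzRingType) (u : R) (n : nat) : R :=
  \prod_(i < n) (u + i%:R).

Section Rising.
Variable R : comPzRingType.
Implicit Types (u v : R).

Lemma rising0 u : rising u 0 = 1.
Proof. exact: big_ord0. Qed.

Lemma risingS u n : rising u n.+1 = rising u n * (u + n%:R).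
Proof. exact: big_ord_recr. Qed.

Lemma risingD u m n : rising u (m + n) = rising u m * rising (u + m%:R) n.
Proof.
elim: n => [|n IHn]; first by rewrite addn0 rising0 mulr1.
by rewrite addnS !risingS IHn natrD addrA mulrA.
Qed.

End Rising.

Section SubsetSums.
Variables (T : finType) (R : comPzRingType).
Implicit Types (S A K : {set T}) (u v x t a b : R).

Lemma sum_subset_setD S (F : {set T} -> R) :
  \sum_(A : {set T} | A \subset S) F A =
  \sum_(A : {set T} | A \subset S) F (S :\: A).
Proof.
rewrite (reindex_onto (fun A => S :\: A) (fun A => S :\: A)) /=; last first.
  by move=> A sAS; rewrite setDDr setDv set0U; apply/setIidPr.
apply: eq_bigl => A; rewrite subsetDl /= setDDr setDv set0U.
by apply/eqP/idP => [<-|/setIidPr //]; rewrite subsetIl.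
Qed.

Lemma exchange_subset_sums S (F : {set T} -> {set T} -> R) :
  \sum_(A : {set T} | A \subset S)
     \sum_(K : {set T} | K \subset S :\: A) F A K =
  \sum_(K : {set T} | K \subset S)
     \sum_(A : {set T} | A \subset S :\: K) F A K.
Proof.
rewrite (exchange_big_dep (fun K : {set T} => K \subset S)) /=; last first.
  by move=> A K _; rewrite subsetD => /andP[].
apply: eq_bigr => K sKS; apply: eq_bigl => A.
by rewrite !subsetD sKS disjoint_sym.
Qed.

Lemma sum_subset_setU1 S z (F : {set T} -> R) : z \notin S ->
  \sum_(A : {set T} | A \subset z |: S) F A =
  \sum_(A : {set T} | A \subset S) (F A + F (z |: A)).
Proof.
move=> zS; rewrite (bigID (fun A : {set T} => z \in A)) /= addrC big_split /=.
congr (_ + _).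
  apply: eq_bigl => A; rewrite -subsetD1 setU1K //.
rewrite (reindex_onto (fun A => z |: A) (fun A => A :\ z)) /=; last first.
  by move=> A /andP[_ zA]; rewrite setD1K.
apply: eq_bigl => A; rewrite setU11 andbT.
apply/andP/idP => [[/subsetP sAS /eqP <-]|sAS].
  by apply/subsetP=> w; rewrite !inE => /andP[/negPf nwz] /orP[|wA];
    [rewrite nwz | have := sAS w; rewrite !inE wA orbT nwz; apply].
rewrite setUS // setU1K //; apply: contra zS; exact: (subsetP sAS).
Qed.

(** When the colour of one more element multiplies the weight by a factor c that
    depends on the size of the set alone, the sum over all 2-colourings is a
    product.  The rising factorials and the powers are the two instances. *)
Lemma sum_2colourings (f g c : nat -> R) S :
    (forall i j, f i.+1 * g j + f i * g j.+1 = f i * g j * c (i + j)%N) ->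
  \sum_(A : {set T} | A \subset S) f #|A| * g #|S :\: A| =
  f 0 * g 0 * \prod_(i < #|S|) c i.
Proof.
move=> fgc; have [n] := ubnP #|S|; elim: n S => // n IHn S leSn.
have [->|[z zS]] := set_0Vmem S.
  rewrite (big_pred1 set0) => [|A]; last by rewrite subset0.
  by rewrite set0D cards0 big_ord0 mulr1.
rewrite -(setD1K zS) in leSn *.
move: (S :\ z) (setD11 z S) leSn => {S zS} S /negbT zS.
rewrite cardsU1 zS ltnS => leSn; rewrite sum_subset_setU1 //.
rewrite big_ord_recr /= mulrA -IHn // mulr_suml; apply: eq_bigr => A sAS.
have zA : z \notin A by apply: contra zS; exact: (subsetP sAS).
have -> : (z |: S) :\: A = z |: (S :\: A).
  by apply/setP=> w; rewrite !inE; case: eqP => [->|//]; rewrite zA.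
have -> : (z |: S) :\: (z |: A) = S :\: A.
  apply/setP=> w; rewrite !inE.
  by case: eqP => [->|//]; rewrite (negPf zS) andbF.
rewrite !cardsU1 zA inE (negPf zS) andbF addrC fgc.
by rewrite -(cardsID A S) (setIidPr sAS).
Qed.

Lemma rising_Vandermonde u v S :
  \sum_(A : {set T} | A \subset S) rising u #|A| * rising v #|S :\: A| =
  rising (u + v) #|S|.
Proof.
rewrite (@sum_2colourings _ _ (fun n => u + v + n%:R)) ?rising0 ?mul1r //.
by move=> i j; rewrite !risingS natrD; ring.
Qed.

Lemma exprD_subset x t S :
  (x + t) ^+ #|S| =
  \sum_(A : {set T} | A \subset S) x ^+ #|A| * t ^+ #|S :\: A|.
Proof.
rewrite (@sum_2colourings _ _ (fun=> x + t)) => [|i j].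
  by rewrite prodr_const card_ord !mul1r.
by rewrite !exprS; ring.
Qed.

(** Expanding (x + t)^k on the right splits each subset S :\: K into a part I
    that gets t and a rest that gets x; for a fixed I the sum over K is then an
    instance of the Vandermonde identity. *)
Lemma meixner_resum x t a b S :
  \sum_(A : {set T} | A \subset S)
     x ^+ #|A| * t ^+ #|S :\: A|
     * (rising (b + #|S :\: A|%:R) #|A| * rising a #|S :\: A|) =
  \sum_(A : {set T} | A \subset S)
     x ^+ #|A| * (x + t) ^+ #|S :\: A|
     * (rising (b - a) #|A| * rising a #|S :\: A|).
Proof.
under [RHS]eq_bigr => K _.
  rewrite addrC exprD_subset mulr_sumr mulr_suml.
over.
rewrite exchange_subset_sums [LHS]sum_subset_setD.
apply: eq_bigr => I sIS.
rewrite setDDr setDv set0U (setIidPr sIS).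
have -> : b + #|I|%:R = b - a + (a + #|I|%:R) by ring.
rewrite -rising_Vandermonde mulr_suml mulr_sumr; apply: eq_bigr => K sKI.
have -> : #|S :\: K| = (#|I| + #|(S :\: I) :\: K|)%N.
  rewrite -(cardsID I (S :\: K)) setDDl [K :|: I]setUC -setDDl; congr (_ + _)%N.
  move: sKI; rewrite subsetD => /andP[_ dKI].
  apply: eq_card => w; rewrite !inE.
  case: (boolP (w \in I)) => [wI|]; rewrite ?andbF ?andbT //.
  rewrite (subsetP sIS) // andbT; apply/negP=> wK.
  by have/pred0P/(_ w) := dKI; rewrite /= wK wI.
have -> : S :\: K :\: I = S :\: I :\: K by rewrite !setDDl setUC.
have -> : #|S :\: I| = (#|K| + #|(S :\: I) :\: K|)%N.
  by rewrite -(cardsID K (S :\: I)) (setIidPr sKI).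
rewrite risingD exprD; ring.
Qed.

End SubsetSums.

(** * Cycle insertion in permutations *)

Definition porbits_in (T : finType) (A : {set T}) (s : {perm T}) :
    {set {set T}} :=
  [set O in porbits s | O \subset A].

Lemma porbit_sub_closed (T : finType) (s : {perm T}) (P : {set T}) z :
  z \in P -> {in P, forall w, s w \in P} -> porbit s z \subset P.
Proof.
move=> Pz sP; apply/subsetP=> _ /porbitP[i ->].
by elim: i => [|i IHi]; rewrite ?perm1 // expgSr permM sP.
Qed.

Section CycleInsertion.
Variables (T : finType) (A : {set T}) (s : {perm T}) (x : T).
Hypotheses (xA : x \in A) (sx : s x = x).

Lemma porbit_fix : porbit s x = [set x].
Proof.
apply/eqP; rewrite eqEsubset sub1set porbit_id andbT.
by apply: porbit_sub_closed => [|w /set1P->]; rewrite ?sx ?set11.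
Qed.

Lemma card_porbits_in_fix : #|porbits_in A s| = #|porbits_in (A :\ x) s|.+1.
Proof.
rewrite (cardsD1 [set x]) inE -{1}porbit_fix imset_f // sub1set xA /= add1n.
congr _.+1; apply: eq_card => O; rewrite !inE; apply/and3P/andP.
  case=> nOx sO OA; split=> //; rewrite subsetD1 OA /=.
  apply: contra nOx => xO; case/imsetP: sO xO => z _ ->.
  by rewrite -eq_porbit_mem => /eqP <-; rewrite porbit_fix.
case=> sO; rewrite subsetD1 => /andP[OA nxO]; split=> //.
by apply: contra nxO => /eqP->; rewrite set11.
Qed.

Variable y : T.
Hypothesis (yx : y != x).
(* [p] inserts the fixed point [x] of [s] between [y] and [s y] *)
Let p := (tperm x y * s)%g.

Let px : p x = s y. Proof. by rewrite permM tpermL. Qed.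
Let py : p y = x. Proof. by rewrite permM tpermR. Qed.
Let pD w : w != x -> w != y -> p w = s w.
Proof. by move=> wx wy; rewrite permM tpermD // eq_sym. Qed.

Lemma porbit_insert z : z != x -> porbit p z :\ x = porbit s z.
Proof.
move=> zx; apply/eqP; rewrite eqEsubset; apply/andP; split.
  (* [r] moves [x] back to [y], so that one step of [p] becomes at most one step
     of [s] *)
  pose r w := if w == x then y else w.
  suff /subsetP sub : porbit p z \subset [set w | r w \in porbit s z].
    apply/subsetP=> w /setD1P[wx /sub].
    by rewrite inE /r (negPf wx).
  have step v w : v \in porbit s w -> w \in porbit s z -> v \in porbit s z.
    by rewrite -!eq_porbit_mem => /eqP ->.
  apply: porbit_sub_closed => [|w]; rewrite inE {1}/r.
    by rewrite (negPf zx) porbit_id.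
  rewrite inE => rw; apply: step rw.
  have sNx v : v != x -> s v != x by rewrite -{2}sx (inj_eq perm_inj).
  rewrite /r; have [->|wx] := eqVneq w x.
    by rewrite px (negPf (sNx _ yx)) (mem_porbit s 1).
  have [->|wy] := eqVneq w y; first by rewrite py eqxx porbit_id.
  by rewrite pD // (negPf (sNx _ wx)) (mem_porbit s 1).
have step v w : v \in porbit p w -> w \in porbit p z -> v \in porbit p z.
  by rewrite -!eq_porbit_mem => /eqP ->.
apply: porbit_sub_closed => [|w]; first by rewrite !inE zx porbit_id.
rewrite !inE => /andP[wx wz]; rewrite -{1}sx (inj_eq perm_inj) wx /=.
apply: step wz; have [->|wy] := eqVneq w y.
  by have := mem_porbit p 2 y; rewrite expgS expg1 permM py px.
by rewrite -pD // (mem_porbit p 1).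
Qed.

(** Removing [x] from the cycles of [p] is a bijection onto the cycles of [s]
    other than the fixed point [x]; as [x] is in [A], it preserves being
    contained in [A]. *)
Lemma card_porbits_in_insert : #|porbits_in A p| = #|porbits_in (A :\ x) s|.
Proof.
(* every cycle of [p] has a representative other than [x]: if [x] is on it, so
   is [y] *)
have repr O : O \in porbits p -> exists2 z, z != x & O = porbit p z.
  case/imsetP=> z _ ->; have [->|] := eqVneq z x; last by exists z.
  exists y => //; apply/eqP; rewrite eq_porbit_mem.
  by have := mem_porbit p 1 y; rewrite expg1 py.
have -> : porbits_in (A :\ x) s = [set O :\ x | O in porbits_in A p].
  apply/setP=> O; apply/idP/imsetP => [|[O' + ->]]; rewrite inE.
    case/andP=> /imsetP[z _ ->]; have [->|zx OA] := eqVneq z x.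
      by move/subsetP/(_ x (porbit_id _ _)); rewrite setD11.
    exists (porbit p z); last by rewrite porbit_insert.
    rewrite inE imset_f //= -(setD1K xA) -subDset.
    by rewrite porbit_insert.
  case/andP=> /repr[z zx ->] OA.
  by rewrite inE {1}porbit_insert // imset_f //= setSD.
rewrite card_in_imset // => O1 O2; rewrite !inE.
case/andP=> /repr[z1 z1x ->] _ /andP[/repr[z2 z2x ->] _] eqO.
have : z1 \in porbit p z2 :\ x by rewrite -eqO !inE z1x porbit_id.
by rewrite !inE -eq_porbit_mem => /andP[_ /eqP].
Qed.

End CycleInsertion.

Section CycleSum.
Variables (T : finType) (R : comPzRingType) (u : R).

(** A permutation p of S is determined by the element y sent to x and by the
    permutation obtained by short-circuiting x. *)
Lemma sum_perm_insert (S : {set T}) x (F : {perm T} -> R) : x \in S ->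
  \sum_(p | perm_on S p) F p =
  \sum_(s | perm_on (S :\ x) s) \sum_(y in S) F (tperm x y * s)%g.
Proof.
move=> xS; rewrite exchange_big /=.
rewrite (partition_big (fun p : {perm T} => (p^-1)%g x) (mem S)) /=; last first.
  by move=> p Sp; rewrite (perm_closed _ (perm_onV Sp)).
apply: eq_bigr => y yS; rewrite (reindex_inj (mulgI (tperm x y))) /=.
have St : perm_on S (tperm x y).
  by apply/subsetP=> w; rewrite inE; case: tpermP => [->|->|]; rewrite ?eqxx.
apply: eq_bigl => s; apply/andP/idP => [[Sp /eqP ps]|Ss].
  have {ps} sx : s x = x.
    by have := permKV (tperm x y * s) x; rewrite ps permM tpermR.
  have Ss : perm_on S s.
    by rewrite -(mulKg (tperm x y) s) perm_onM ?perm_onV.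
  apply/subsetP=> w; rewrite !inE => nw; apply/andP; split.
    by apply: contraNneq nw => ->; rewrite sx.
  by apply: (subsetP Ss); rewrite inE.
split; first by apply: perm_onM => //; apply: subset_trans Ss (subD1set _ _).
by rewrite -(inj_eq (@perm_inj _ (tperm x y * s))) permKV permM tpermR
  (out_perm Ss) // setD11.
Qed.

(** Inserting the elements of A one at a time into a permutation of S :\: A, the
    i-th one (from 0) can close a new cycle inside A, with weight u, or follow
    any of the #|S :\: A| + i elements already present. *)
Lemma sum_perm_porbits_in (A S : {set T}) : A \subset S ->
  \sum_(s | perm_on S s) u ^+ #|porbits_in A s| =
  #|S :\: A|`!%:R * rising (u + #|S :\: A|%:R) #|A|.
Proof.
have [n] := ubnP #|A|; elim: n A S => // n IHn A S leAn sAS.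
have [->|[x xA]] := set_0Vmem A.
  rewrite cards0 rising0 mulr1 setD0 -card_perm -sum1_card natr_sum.
  apply: eq_bigr => s _; rewrite (_ : porbits_in _ _ = set0) ?cards0 //.
  apply/setP=> O; rewrite !inE subset0.
  apply/negP=> /andP[/imsetP[z _ ->]] /eqP O0.
  by have := porbit_id s z; rewrite O0 inE.
have xS : x \in S by apply: (subsetP sAS).
have cA := cardsD1 x A; rewrite xA add1n in cA.
rewrite (sum_perm_insert _ xS) cA risingS mulrA.
have -> : S :\: A = (S :\ x) :\: (A :\ x).
  by apply/setP=> w; rewrite !inE; case: eqP => // ->; rewrite xA.
rewrite -IHn ?setSD //; last by rewrite -ltnS -cA.
rewrite mulr_suml; apply: eq_bigr => s Ss.
have sx : s x = x by rewrite (out_perm Ss) // setD11.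
rewrite (bigD1 x) //= tperm1 mul1g (card_porbits_in_fix xA sx).
rewrite (eq_bigr (fun=> u ^+ #|porbits_in (A :\ x) s|)); last first.
  by move=> y /andP[_ yx]; rewrite (card_porbits_in_insert xA sx yx).
rewrite sumr_const exprSr -[X in _ + X]mulr_natr -mulrDr; congr (_ * _).
rewrite -addrA; congr (_ + _); rewrite -natrD; congr _%:R.
have -> : #|(fun y => (y \in S) && (y != x))| = #|S :\ x|.
  by apply: eq_card => w; rewrite !inE andbC.
by rewrite -(cardsID (A :\ x) (S :\ x)) (setIidPr (setSD _ sAS)) addnC.
Qed.

End CycleSum.

(** * Injections as restrictions of permutations *)

(** Induction on A: if s agrees with f on A minus x, precomposing s with the
    transposition of x and z := s^-1 (f x) corrects the value at x; the element
    z is not in A minus x, because f is injective. *)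
Lemma extend_to_perm (T : finType) (A S : {set T}) (f : T -> T) :
  A \subset S -> {in A &, injective f} -> {in A, forall x, f x \in S} ->
  exists2 s : {perm T}, perm_on S s & {in A, s =1 f}.
Proof.
have [n] := ubnP #|A|; elim: n A => // n IHn A leAn sAS injf fS.
have [->|[x xA]] := set_0Vmem A.
  by exists 1%g => [|w]; rewrite ?perm_on1 ?inE.
have cA := cardsD1 x A; rewrite xA add1n in cA.
have subA : A :\ x \subset A := subD1set A x.
have [||||s Ss sf] := IHn (A :\ x); first by rewrite -ltnS -cA.
- exact: subset_trans sAS.
- by move=> v w vA wA; apply: injf; apply: (subsetP subA).
- by move=> w wA; apply: fS; apply: (subsetP subA).
pose z := (s^-1)%g (f x).
have sz : s z = f x by rewrite permKV.
have xS : x \in S := subsetP sAS x xA.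
have zS : z \in S by rewrite (perm_closed _ (perm_onV Ss)) fS.
exists (tperm x z * s)%g.
  apply: perm_onM Ss; apply/subsetP=> w; rewrite inE.
  by case: tpermP => [->|->|]; rewrite ?eqxx.
move=> w wA; rewrite permM; have [->|wx] := eqVneq w x; first by rewrite tpermL.
have wA' : w \in A :\ x by rewrite !inE wx.
rewrite tpermD ?sf // eq_sym //; apply: contraNneq wx => wz.
by apply/eqP; apply: injf => //; rewrite -sf // wz.
Qed.

Section InjectionCycles.
Variables (T : finType) (A S : {set T}).
Implicit Types (f : injection A S) (s : {perm T}).

Definition extends f s := [forall k : {x | x \in A}, s (val k) == val (val f k)].

Lemma extendsP f s :
  reflect (forall x (xA : x \in A), s x = val (val f (exist _ x xA))) (extends f s).
Proof.
apply: (iffP forallP) => [fs x xA|fs [x xA]]; first exact/eqP/(fs (exist _ x xA)).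
by apply/eqP/fs.
Qed.

Lemma functional_digraph_extends f s x y : extends f s ->
  functional_digraph f x y = (x \in A) && (s x == y).
Proof.
move/extendsP=> fs; apply/existsP/andP => [[[z zA] /= /andP[/eqP <-]]|[xA]].
  by rewrite fs.
by rewrite fs => sxy; exists (exist _ x xA); rewrite /= eqxx.
Qed.

(** On its vertex set, which lies in A, a cycle of the functional digraph of f
    follows s; conversely s agrees with f on an orbit contained in A. *)
Lemma injection_cycles_extends f s : extends f s ->
  injection_cycles f = porbits_in A s.
Proof.
move=> fs; apply/setP=> O; rewrite !inE.
apply/andP/andP => [[/set0Pn[x xO]]|].
  case/existsP=> t /andP[/andP[ct _] /eqP Ot].
  rewrite Ot inE in xO.
  have sc : fcycle s t.
    apply: sub_cycle ct => v w.
    by rewrite (functional_digraph_extends _ _ fs) => /andP[].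
  split; last first.
    apply/subsetP=> w; rewrite Ot inE => /(next_cycle ct).
    by rewrite (functional_digraph_extends _ _ fs) => /andP[].
  apply/imsetP; exists x => //; apply/setP=> w; rewrite Ot inE.
  rewrite -(fconnect_cycle sc xO); apply/idP/porbitP => [/iter_findex <-|[i ->]].
    by exists (findex s x w); rewrite permX.
  by rewrite permX fconnect_iter.
case=> /imsetP[x _ ->] OA; split; first by apply/set0Pn; exists x; apply: porbit_id.
have sz : size (traject s x #|porbit s x|) == #|porbit s x| by rewrite size_traject.
apply/existsP; exists (Tuple sz); apply/andP; split; last first.
  by apply/eqP/setP=> w; rewrite inE porbit_traject.
apply/andP; split; last exact: uniq_traject_porbit.
apply: (@sub_in_cycle _ (mem A) (frel s)) => [v w vA _ svw||].
- by rewrite (functional_digraph_extends _ _ fs); apply/andP.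
- by apply/allP=> w; rewrite -porbit_traject => /(subsetP OA).
rewrite /=; case def_n: #|porbit s x| => [//|n].
rewrite /= rcons_path fpath_traject /= last_traject.
by rewrite -{2}(iter_porbit s x) def_n.
Qed.

Hypothesis sAS : A \subset S.

Lemma exists_extends f : exists2 s, perm_on S s & extends f s.
Proof.
pose g x := if insub x is Some k then val (val f k) else x.
have gE x (xA : x \in A) : g x = val (val f (exist _ x xA)) by rewrite /g insubT.
have [||s Ss sg] := @extend_to_perm T A S g sAS.
- move=> x y xA yA; rewrite !gE => /val_inj /(injectiveP _ (valP f)).
  by case.
- by move=> x xA; rewrite gE; apply: valP.
by exists s => //; apply/extendsP=> x xA; rewrite sg // gE.
Qed.

(** The extensions of f are the products q * s0 of one of them with the
    permutations q of S :\: A. *)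
Lemma card_extends f :
  #|[set s : {perm T} | perm_on S s & extends f s]| = #|S :\: A|`!.
Proof.
have [s0 Ss0 /extendsP fs0] := exists_extends f.
rewrite -card_perm -(card_imset (mem (perm_on (S :\: A))) (mulIg s0)).
apply: eq_card => s; rewrite inE.
apply/andP/imsetP => [[Ss /extendsP fs]|[q Dq ->]].
  exists (s * s0^-1)%g; last by rewrite mulgKV.
  apply/subsetP=> x; rewrite !inE permM => nx; apply/andP; split.
    by apply: contra nx => xA; rewrite fs -fs0 permK.
  apply: contraR nx => xS; rewrite (out_perm Ss) //.
  by rewrite (out_perm (perm_onV Ss0)).
split; first by apply: perm_onM Ss0; apply: subset_trans Dq (subsetDl _ _).
apply/extendsP=> x xA; rewrite permM (out_perm Dq) ?fs0 //.
by rewrite inE xA.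
Qed.

Lemma restrict_extends s : perm_on S s -> {f | extends f s}.
Proof.
move=> Ss; have sP (k : {x | x \in A}) : s (val k) \in S.
  by rewrite (perm_closed _ Ss) (subsetP sAS) ?(valP k).
pose f := [ffun k : {x | x \in A} => exist (fun y => y \in S) (s (val k)) (sP k)].
have injf : injectiveb f.
  by apply/injectiveP=> k l; rewrite !ffunE => -[/perm_inj /val_inj].
exists (exist _ f injf : injection A S).
by apply/extendsP=> x xA; rewrite /= ffunE.
Qed.

Lemma extends_inj f g s : extends f s -> extends g s -> f = g.
Proof.
move=> /extendsP fs /extendsP gs; apply/val_inj/ffunP=> -[x xA].
by apply: val_inj; rewrite -fs -gs.
Qed.

End InjectionCycles.

(** Double counting of the pairs (f, s) where s is a permutation of S extending
    f.  The factor #|S :\: A|`! has to be cancelled, hence the characteristic. *)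
Lemma sum_injection_cycles (T : finType) (R : idomainType) (u : R)
    (A S : {set T}) : [pchar R] =i pred0 -> A \subset S ->
  \sum_(f : injection A S) u ^+ #|injection_cycles f| =
  rising (u + #|S :\: A|%:R) #|A|.
Proof.
move=> charR sAS.
have d0 : #|S :\: A|`!%:R != 0 :> R.
  by move/pcharf0P: charR => ->; rewrite -lt0n fact_gt0.
apply: (mulfI d0); rewrite -sum_perm_porbits_in // mulr_sumr.
transitivity (\sum_(f : injection A S) \sum_(s | perm_on S s && extends f s)
    u ^+ #|porbits_in A s|).
  apply: eq_bigr => f _; rewrite -(card_extends sAS f) mulr_natl -sumr_const.
  apply: eq_big => [s|s]; rewrite inE // => /andP[_ fs].
  by rewrite (injection_cycles_extends fs).
rewrite (exchange_big_dep (fun s => perm_on S s)) /=; last by move=> f s _ /andP[].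
apply: eq_bigr => s Ss; have [f fs] := restrict_extends sAS Ss.
rewrite (big_pred1 f) // => g; rewrite Ss /=; apply/idP/eqP => [gs|->//].
exact: extends_inj gs fs.
Qed.

Lemma sum_perm_cycles (T : finType) (R : comPzRingType) (v : R) (B : {set T}) :
  \sum_(s : perm_of_set B) v ^+ #|perm_cycles s| = rising v #|B|.
Proof.
have := sum_perm_porbits_in v (subxx [set: {x | x \in B}]).
rewrite setDv cards0 fact0 mul1r addr0 cardsT card_sig => <-.
apply: eq_big => [s|s _]; first by symmetry; apply/subsetP=> x; rewrite inE.
by congr (_ ^+ _); apply: eq_card => O; rewrite [in RHS]inE subsetT andbT.
Qed.

(** * Sums over compositions and Meixner structures *)

Section CompositionSums.
Variables (T : finType) (R : nmodType).
Implicit Types A B C : {set T}.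

Lemma is_composition2E A B : is_composition2 (A, B) = (B == ~: A).
Proof.
apply/andP/eqP => [[dAB /eqP/setP cAB]|->].
  apply/setP=> x; have := cAB x; have/pred0P/(_ x) := dAB.
  by rewrite !inE /=; case: (x \in A) (x \in B) => [] [].
by rewrite -setI_eq0 setICr setUCr !eqxx.
Qed.

Lemma is_composition3E A B C :
  is_composition3 (A, B, C) = (A \subset ~: C) && (B == ~: C :\: A).
Proof.
rewrite -disjoints_subset.
apply/and4P/andP => [[dAB dAC dBC /eqP/setP cABC]|[dAC /eqP->]].
  split=> //; apply/eqP/setP=> x; have := cABC x.
  have/pred0P/(_ x) := dAB; have/pred0P/(_ x) := dBC.
  by rewrite !inE /=; case: (x \in A) (x \in B) (x \in C) => [] [] [].
split=> //.
- by rewrite disjoint_sym disjoints_subset setDE subsetIr.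
- by rewrite disjoints_subset subsetDl.
by apply/eqP/setP=> x; rewrite !inE; case: (x \in A) (x \in C) => [] [].
Qed.

Lemma sum_composition2 (F : {set T} -> {set T} -> R) :
  \sum_(c : composition2 T) F (block2A c) (block2B c) =
  \sum_(A : {set T}) F A (~: A).
Proof.
transitivity (\sum_(c in @is_composition2 T) F c.1 c.2).
  by symmetry; exact: (big_sub (@is_composition2 T)).
rewrite (eq_bigl (fun c => is_composition2 (c.1, c.2))); last by case.
rewrite -(pair_big_dep xpredT (fun A B => is_composition2 (A, B)) F) /=.
by apply: eq_bigr => A _; apply: big_pred1 => B; apply: is_composition2E.
Qed.

Lemma sum_composition3 (F : {set T} -> {set T} -> {set T} -> R) :
  \sum_(c : composition3 T) F (block3A c) (block3B c) (block3C c) =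
  \sum_(C : {set T}) \sum_(A : {set T} | A \subset ~: C) F A (~: C :\: A) C.
Proof.
transitivity (\sum_(c in @is_composition3 T) F c.1.1 c.1.2 c.2).
  by symmetry; exact: (big_sub (@is_composition3 T)).
rewrite (eq_bigl (fun c => is_composition3 (c.1, c.2))); last by case.
rewrite -(pair_big_dep xpredT (fun AB C => is_composition3 (AB, C))
            (fun AB C => F AB.1 AB.2 C)) /=.
rewrite (exchange_big_dep xpredT) //=; apply: eq_bigr => C _.
rewrite (eq_bigl (fun AB : {set T} * {set T} =>
                    (AB.1 \subset ~: C) && (AB.2 == ~: C :\: AB.1))).
  rewrite -(pair_big_dep (fun A => A \subset ~: C) (fun A B => B == ~: C :\: A)
              (fun A B => F A B C)) /=.
  by apply: eq_bigr => A _; apply: big_pred1.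
by case=> A B; apply: is_composition3E.
Qed.

End CompositionSums.

Section MeixnerSums.
Variables (T : finType) (R : idomainType).
Hypothesis charR : [pchar R] =i pred0.
Variables (a b u v w : R).

Lemma sum_meixner_endo :
  \sum_(g : meixner_endo T)
    (let: existT c (f, s) := g in
     a ^+ #|block2A c| * b ^+ #|block2B c|
     * (u ^+ #|injection_cycles f| * v ^+ #|perm_cycles s|)) =
  \sum_(A : {set T}) a ^+ #|A| * b ^+ #|~: A|
     * (rising (u + #|~: A|%:R) #|A| * rising v #|~: A|).
Proof.
rewrite -(sum_composition2 (fun A B => a ^+ #|A| * b ^+ #|B|
     * (rising (u + #|B|%:R) #|A| * rising v #|B|))).
transitivity (\sum_(c : composition2 T)
  \sum_(p : injection (block2A c) (block2A c :|: block2B c)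
            * perm_of_set (block2B c))
   a ^+ #|block2A c| * b ^+ #|block2B c|
     * (u ^+ #|injection_cycles p.1| * v ^+ #|perm_cycles p.2|)).
  rewrite (sig_big_dep _ (fun c => xpredT)
   (fun c p =>  a ^+ #|block2A c| * b ^+ #|block2B c|
     * (u ^+ #|injection_cycles p.1| * v ^+ #|perm_cycles p.2|))).
  by apply: eq_bigr => -[c [f s]].
apply: eq_bigr => c _; rewrite -mulr_sumr; congr (_ * _).
rewrite -(pair_bigA _ (fun f s =>
            u ^+ #|injection_cycles f| * v ^+ #|perm_cycles s|)) /=.
rewrite -(sum_perm_cycles v) -big_distrlr; congr (_ * _).
rewrite sum_injection_cycles ?subsetUl // setDUl setDv set0U.
rewrite /block2A /block2B; case: (val c) (valP c) => A B /= /andP[dAB _].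
by have /setDidPl -> : [disjoint B & A] by rewrite disjoint_sym.
Qed.

Lemma sum_meixner_bi_endo (d : R) :
  \sum_(g : meixner_bi_endo T)
    (let: existT c (f, s, t) := g in
     a ^+ #|block3A c| * b ^+ #|block3B c| * d ^+ #|block3C c|
     * (u ^+ #|injection_cycles f| * v ^+ #|perm_cycles s|
        * w ^+ #|perm_cycles t|)) =
  \sum_(C : {set T}) \sum_(A : {set T} | A \subset ~: C)
     a ^+ #|A| * b ^+ #|~: C :\: A| * d ^+ #|C|
     * (rising (u + #|~: C :\: A|%:R) #|A| * rising v #|~: C :\: A|
        * rising w #|C|).
Proof.
rewrite -(sum_composition3 (fun A B C => a ^+ #|A| * b ^+ #|B| * d ^+ #|C|
     * (rising (u + #|B|%:R) #|A| * rising v #|B| * rising w #|C|))).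
transitivity (\sum_(c : composition3 T)
  \sum_(p : injection (block3A c) (block3A c :|: block3B c)
            * perm_of_set (block3B c)
            * perm_of_set (block3C c))
   a ^+ #|block3A c| * b ^+ #|block3B c| * d ^+ #|block3C c|
     * (u ^+ #|injection_cycles p.1.1| * v ^+ #|perm_cycles p.1.2|
        * w ^+ #|perm_cycles p.2|)).
  rewrite (sig_big_dep _ (fun c => xpredT)
   (fun c p =>  a ^+ #|block3A c| * b ^+ #|block3B c| * d ^+ #|block3C c|
     * (u ^+ #|injection_cycles p.1.1| * v ^+ #|perm_cycles p.1.2|
        * w ^+ #|perm_cycles p.2|))).
  by apply: eq_bigr => -[c [[f s] t]].
apply: eq_bigr => c _; rewrite -mulr_sumr; congr (_ * _).
rewrite -(pair_bigA _ (fun fs t =>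
            u ^+ #|injection_cycles fs.1| * v ^+ #|perm_cycles fs.2| * w ^+ #|perm_cycles t|)) /=.
rewrite -(sum_perm_cycles w) -big_distrlr; congr (_ * _).
rewrite -(pair_bigA _ (fun f s =>
            u ^+ #|injection_cycles f| * v ^+ #|perm_cycles s|)) /=.
rewrite -(sum_perm_cycles v) -big_distrlr; congr (_ * _).
rewrite sum_injection_cycles ?subsetUl // setDUl setDv set0U.
rewrite /block3A /block3B; case: (val c) (valP c) => -[A B] C /=.
case/and4P=> dAB _ _ _.
by have /setDidPl -> : [disjoint B & A] by rewrite disjoint_sym.
Qed.

End MeixnerSums.

(** * The identity between the two sums *)

(** With b = u, a = v and t = 1 - x, [meixner_resum] turns the inner sum on the
    left into one without powers of x + t; the colour C then joins the colour
    of weight [rising v] by the Vandermonde identity.  The right side is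
    [meixner_resum] with its x, t, b, a equal to 1, x - 1, u + w, u - v. *)
Lemma meixner_identity (T : finType) (R : comPzRingType) (x u v w : R) :
  \sum_(C : {set T}) \sum_(A : {set T} | A \subset ~: C)
     x ^+ #|A| * (1 - x) ^+ #|~: C :\: A|
     * (rising (u + #|~: C :\: A|%:R) #|A| * rising v #|~: C :\: A|
        * rising w #|C|) =
  \sum_(A : {set T}) (x - 1) ^+ #|~: A|
     * (rising (u + w + #|~: A|%:R) #|A| * rising (u - v) #|~: A|).
Proof.
(* the common value of both sides, where [K] collects the powers of [x] *)
transitivity (\sum_(K : {set T})
    x ^+ #|K| * rising (u - v) #|K| * rising (v + w) #|~: K|).
  transitivity (\sum_(C : {set T} | C \subset setT)
      \sum_(K : {set T} | K \subset setT :\: C)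
        x ^+ #|K| * rising (u - v) #|K|
        * (rising v #|setT :\: K :\: C| * rising w #|C|)).
    apply: eq_big => [C|C _]; first by rewrite subsetT.
    rewrite setTD.
    under eq_bigr do rewrite mulrA.
    rewrite -mulr_suml meixner_resum mulr_suml; apply: eq_bigr => K _.
    rewrite subrKC expr1n setTD [in RHS]setDE setIC -setDE; ring.
  rewrite exchange_subset_sums.
  apply: eq_big => [K|K _]; first by rewrite subsetT.
  rewrite -mulr_sumr setTD [v + w]addrC -(rising_Vandermonde w v); congr (_ * _).
  by apply: eq_bigr => C _; rewrite mulrC.
transitivity (\sum_(A : {set T} | A \subset setT)
    1 ^+ #|A| * (x - 1) ^+ #|setT :\: A|
    * (rising (u + w + #|setT :\: A|%:R) #|A| * rising (u - v) #|setT :\: A|)).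
  rewrite meixner_resum sum_subset_setD.
  apply: eq_big => [K|K _]; first by rewrite subsetT.
  rewrite !setTD setCK expr1n subrKC (_ : u + w - (u - v) = v + w); ring.
apply: eq_big => [A|A _]; first by rewrite subsetT.
by rewrite setTD expr1n mul1r mulrA.
Qed.

Theorem theorem2p4 (m : nat) :
  \sum_(g : meixner_bi_endo 'I_m) bi_endo_weight g =
  \sum_(g : meixner_endo 'I_m) endo_weight g.
Proof.
have charP : [pchar {poly rat}] =i pred0.
  by move=> p; rewrite pchar_poly; apply: Num.Theory.pchar_num.
pose h : {poly rat} := (2^-1)%:P.
(* [ring] sees [h] as an atom, so that its value 1/2 enters through [hh] *)
have hh : h + h = 1 by rewrite -polyCD -polyC1; congr _%:P.
pose x := h * (1 - 'X).
transitivity (\sum_(C : {set 'I_m}) \sum_(A : {set 'I_m} | A \subset ~: C)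
     x ^+ #|A| * (1 - x) ^+ #|~: C :\: A| * 1 ^+ #|C|
     * (rising (h + #|~: C :\: A|%:R) #|A| * rising (- m%:R - h) #|~: C :\: A|
        * rising (- m%:R) #|C|)).
  rewrite -sum_meixner_bi_endo //; apply: eq_bigr => -[c [[f s] t]] _.
  rewrite /bi_endo_weight !prodr_const !mulrA -mul_polyC -/h.
  congr (_ ^+ _ * _ ^+ _ * _ * _ * _ * _).
  - by rewrite addrC.
  - rewrite -mul_polyC -/h /x -[X in X - _]hh; ring.
  - by rewrite rmorphB rmorphN rmorph_nat.
  - by rewrite rmorphN rmorph_nat.
transitivity (\sum_(A : {set 'I_m}) 1 ^+ #|A| * (x - 1) ^+ #|~: A|
     * (rising (h - m%:R + #|~: A|%:R) #|A| * rising (1 + m%:R) #|~: A|)).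
  under eq_bigr do under eq_bigr do rewrite expr1n mulr1.
  rewrite meixner_identity //; apply: eq_bigr => A _; rewrite expr1n mul1r.
  have -> // : h - (- m%:R - h) = 1 + m%:R by rewrite -hh; ring.
rewrite -sum_meixner_endo //; apply: eq_bigr => -[c [f s]] _.
rewrite /endo_weight !prodr_const !mulrA -mul_polyC -/h.
congr (_ * _ ^+ _ * _ ^+ _ * _ ^+ _).
- rewrite /x -[X in _ - X = _]hh; ring.
- by rewrite rmorphB rmorph_nat.
- by rewrite rmorphD rmorph_nat rmorph1.
Qed.
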